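(* Let $\Delta t>0$. Assume that the metric matrices $\mathbf{A}_{\nu,h}^n$, $\mathbf{A}_{\tau,h}^n$ are symmetric and positive definite on the relevant discrete velocity spaces ($\mathbb{W}_h^n$ for the normal one, $\mathbb{R}^N$ for the tangential one) and that the stabilization matrices $\mathbf{D}_{\nu,h}^n,\mathbf{D}_{\tau,h}^n$ are symmetric and positive semi-definite. Suppose that $r_{\mathrm g,h}^{n+1}\ne 0$ and that $\mathbf{V}_\nu^{n+1},\mathbf{V}_\tau^{n+1},r_{\mathrm g,h}^{n+1},r_{\mathrm m,h}^{n+1},\lambda_{1,h}^{n+1},\dots,\lambda_{K,h}^{n+1}$ satisfy the fully discrete algebraic system (defined in the context). Then $$\frac{(r_{\mathrm g,h}^{n+1})^2-(r_{\mathrm g,h}^n)^2}{\Delta t}\le-(\mathbf{V}_\nu^{n+1})^\top\mathbf{A}_{\nu,h}^n\mathbf{V}_\nu^{n+1}-\Delta t\,(\mathbf{V}_\nu^{n+1})^\top\mathbf{D}_{\nu,h}^n\mathbf{V}_\nu^{n+1}\le 0,$$ $$\frac{(r_{\mathrm m,h}^{n+1})^2-(r_{\mathrm m,h}^n)^2}{\Delta t}\le-(\mathbf{V}_\tau^{n+1})^\top\mathbf{A}_{\tau,h}^n\mathbf{V}_\tau^{n+1}-\Delta t\,(\mathbf{V}_\tau^{n+1})^\top\mathbf{D}_{\tau,h}^n\mathbf{V}_\tau^{n+1}\le 0.$$ Consequently, the fully discrete modified geometric and mesh SAV energies $(r_{\mathrm g,h}^n)^2$ and $(r_{\mathrm m,h}^n)^2$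 are nonincreasing in $n$.
   Context: Polygonal curve. $\bm{\gamma}_h^n$ is a closed polygon with vertices $\mathbf{x}_1^n,\dots,\mathbf{x}_N^n\in\mathbb{R}^2$ ($\mathbf{x}_{N+1}^n=\mathbf{x}_1^n$). $\mathbb{V}_h^n$ is the space of periodic continuous piecewise linear functions on it, with nodal basis $\chi_1^n,\dots,\chi_N^n$, $\chi_j^n(\mathbf{x}_k^n)=\delta_{jk}$. $(\cdot,\cdot)_h^n$ is the discrete $L^2$ inner product on $\bm{\gamma}_h^n$. With edge tangents $\bm{\tau}_{j+1/2}^n=(\mathbf{x}_{j+1}^n-\mathbf{x}_j^n)/|\mathbf{x}_{j+1}^n-\mathbf{x}_j^n|$, the nodal tangent is $\bm{\tau}_j^n=(\bm{\tau}_{j-1/2}^n+\bm{\tau}_{j+1/2}^n)/|\bm{\tau}_{j-1/2}^n+\bm{\tau}_{j+1/2}^n|$ (denominators assumed nonzero), and the nodal normal $\bm{\nu}_j^n$ is its rotation by $\pi/2$, so that $(\bm{\tau}_j^n,\bm{\nu}_j^n)$ is a positively oriented orthonormal basis. Frozen data, evaluated on $\bm{\gamma}_h^n$. Discrete scalar fields: $w_{\mathrm g,h}^n$ (normal force of a geometric energy $E_{\mathrm{geom}}$, where $\nabla_{L^2}E_{\mathrm{geom}}=w_{\mathrm g}\bm{\nu}$), $w_{\mathrm m,h}^n$ (tangential force of a mesh energy $E_{\mathrm{mesh}}$), $g_{i,h}^n$ (constraint gradients, where $\nabla_{L^2}C_i=g_i\bm{\nu}$, for constraint functionals $C_1,\dots,C_K$).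 Bilinear forms on $\mathbb{V}_h^n$: metrics $\mathcal{G}_{\nu,h}^n,\mathcal{G}_{\tau,h}^n$ and stabilizations $\mathcal{D}_{\nu,h}^n,\mathcal{D}_{\tau,h}^n$. Matrices and vectors: $$[\mathbf{A}_{\nu,h}^n]_{kj}=\mathcal{G}_{\nu,h}^n(\chi_j^n,\chi_k^n),\quad[\mathbf{A}_{\tau,h}^n]_{kj}=\mathcal{G}_{\tau,h}^n(\chi_j^n,\chi_k^n),\quad[\mathbf{D}_{\nu,h}^n]_{kj}=\mathcal{D}_{\nu,h}^n(\chi_j^n,\chi_k^n),\quad[\mathbf{D}_{\tau,h}^n]_{kj}=\mathcal{D}_{\tau,h}^n(\chi_j^n,\chi_k^n),$$ $$\mathbf{M}_{\nu,h}^n=\mathbf{A}_{\nu,h}^n+\Delta t\,\mathbf{D}_{\nu,h}^n,\qquad\mathbf{M}_{\tau,h}^n=\mathbf{A}_{\tau,h}^n+\Delta t\,\mathbf{D}_{\tau,h}^n,$$ $$[\mathbf{F}_{\mathrm g,h}^n]_k=(w_{\mathrm g,h}^n,\chi_k^n)_h^n,\quad[\mathbf{F}_{\mathrm m,h}^n]_k=(w_{\mathrm m,h}^n,\chi_k^n)_h^n,\quad[\mathbf{G}_{i,h}^n]_k=(g_{i,h}^n,\chi_k^n)_h^n.$$ $S_{\mathrm g,h}^n=\sqrt{E_{\mathrm{geom}}(\bm{\gamma}_h^n)+C_{\mathrm g}}$ and $S_{\mathrm m,h}^n=\sqrt{E_{\mathrm{mesh}}(\bm{\gamma}_h^n)+C_{\mathrm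 m}}$, with fixed constants $C_{\mathrm g},C_{\mathrm m}>0$ such that the radicands are positive. Normal velocity space $\mathbb{W}_h^n\subseteq\mathbb{R}^N$. In general (e.g. $L^2$ normal metric) $\mathbb{W}_h^n=\mathbb{R}^N$. For the $H^{-1}$ normal metric, $\mathbb{W}_h^n=\{\mathbf{u}\in\mathbb{R}^N:(\mathbf{m}^n)^\top\mathbf{u}=0\}$, where $\mathbf{m}^n$ is the vector of diagonal entries of the lumped mass matrix $\mathbf{M}_{\mathrm L,h}^n$, and $\mathbf{A}_{\nu,h}^n=\mathbf{M}_{\mathrm L,h}^n(\mathbf{K}_h^n)^\dagger\mathbf{M}_{\mathrm L,h}^n$ with $\mathbf{K}_h^n$ the stiffness matrix on $\bm{\gamma}_h^n$ and $\dagger$ the Moore–Penrose inverse; in that case the normal velocity is sought in $\mathbb{W}_h^n$ and the normal velocity equation is understood as an equation posed on $\mathbb{W}_h^n$ (i.e. tested against all vectors of $\mathbb{W}_h^n$). Fully discrete algebraic system. Given $\bm{\gamma}_h^n$, $r_{\mathrm g,h}^n,r_{\mathrm m,h}^n\in\mathbb{R}$, find $\mathbf{V}_\nu^{n+1}\in\mathbb{W}_h^n$, $\mathbf{V}_\tau^{n+1}\in\mathbb{R}^N$, $r_{\mathrm g,h}^{n+1},r_{\mathrm m,h}^{n+1}\in\mathbb{R}$, $\lambda_{1,h}^{n+1},\dots,\lambda_{K,h}^{n+1}\in\mathbb{R}$ such that $$\mathbf{M}_{\nu,h}^n\mathbf{V}_\nu^{n+1}=-\frac{r_{\mathrm g,h}^{n+1}}{S_{\mathrm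 g,h}^n}\mathbf{F}_{\mathrm g,h}^n-\sum_{i=1}^K\lambda_{i,h}^{n+1}\mathbf{G}_{i,h}^n,$$ $$\mathbf{M}_{\tau,h}^n\mathbf{V}_\tau^{n+1}=-\frac{r_{\mathrm m,h}^{n+1}}{S_{\mathrm m,h}^n}\mathbf{F}_{\mathrm m,h}^n,$$ $$\frac{r_{\mathrm g,h}^{n+1}-r_{\mathrm g,h}^n}{\Delta t}=\frac{1}{2S_{\mathrm g,h}^n}(\mathbf{F}_{\mathrm g,h}^n)^\top\mathbf{V}_\nu^{n+1}+\sum_{i=1}^K\frac{\lambda_{i,h}^{n+1}}{2r_{\mathrm g,h}^{n+1}}(\mathbf{G}_{i,h}^n)^\top\mathbf{V}_\nu^{n+1},$$ $$\frac{r_{\mathrm m,h}^{n+1}-r_{\mathrm m,h}^n}{\Delta t}=\frac{1}{2S_{\mathrm m,h}^n}(\mathbf{F}_{\mathrm m,h}^n)^\top\mathbf{V}_\tau^{n+1},$$ $$\mathbf{x}_j^{n+1}=\mathbf{x}_j^n+\Delta t\big([\mathbf{V}_\nu^{n+1}]_j\bm{\nu}_j^n+[\mathbf{V}_\tau^{n+1}]_j\bm{\tau}_j^n\big),\quad j=1,\dots,N,$$ $$C_i(\bm{\gamma}_h^{n+1})=0,\quad i=1,\dots,K,$$ where $\bm{\gamma}_h^{n+1}$ is the closed polygon with vertices $\mathbf{x}_j^{n+1}$. *)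

(* Defs.v *)
From mathcomp Require Import all_boot all_order all_algebra.
From mathcomp Require Import boolp classical_sets reals.

Set Implicit Arguments.
Unset Strict Implicit.
Unset Printing Implicit Defensive.

Import Order.TTheory GRing.Theory Num.Theory.

Local Open Scope ring_scope.

Section LinearAlgebra.
Variable R : realType.

Definition dotv n (u v : 'cV[R]_n) : R := (u^T *m v) 0 0.

Definition quad n (A : 'M[R]_n) (u : 'cV[R]_n) : R := (u^T *m A *m u) 0 0.

Definition symmetric_mx n (A : 'M[R]_n) : Prop := A^T = A.

Definition pos_def_on n (W : set 'cV[R]_n) (A : 'M[R]_n) : Prop :=
  forall u, W u -> u != 0 -> 0 < quad A u.

Definition pos_semidef n (A : 'M[R]_n) : Prop := forall u, 0 <= quad A u.

(* The four Penrose conditions. *)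
Definition is_moore_penrose m n (A : 'M[R]_(m, n)) (B : 'M[R]_(n, m)) : Prop :=
  [/\ A *m B *m A = A, B *m A *m B = B,
      (A *m B)^T = A *m B & (B *m A)^T = B *m A].

(* The default value 0 of [xget] is never reached: see [moore_penroseP]. *)
Definition moore_penrose m n (A : 'M[R]_(m, n)) : 'M[R]_(n, m) :=
  xget 0 [set B | is_moore_penrose A B]%classic.

Lemma gram_unitmx m n (A : 'M[R]_(m, n)) : row_free A -> A *m A^T \in unitmx.
Proof.
move=> freeA; rewrite -row_free_unit -kermx_eq0; apply/eqP/row_matrixP => i.
rewrite row0; set x := row i _.
have x0 : x *m (A *m A^T) = 0.
  by rewrite /x -row_mul mulmx_ker row0.
have xA0 : x *m A = 0.
  have : \sum_j ((x *m A) 0 j) ^+ 2 = 0.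
    transitivity ((x *m A *m (x *m A)^T) 0 0).
      by rewrite [RHS]mxE; apply: eq_bigr => j _; rewrite [X in _ = _ * X]mxE expr2.
    by rewrite trmx_mul mulmxA -(mulmxA x) x0 mul0mx mxE.
  move/psumr_eq0P => h; apply/rowP => j; rewrite [RHS]mxE; apply/eqP.
  by rewrite -sqrf_eq0 h // => k _; rewrite sqr_ge0.
by apply: (row_free_inj freeA); rewrite xA0 mul0mx.
Qed.

Lemma moore_penroseP m n (A : 'M[R]_(m, n)) :
  is_moore_penrose A (moore_penrose A).
Proof.
suff [B AB] : exists B, is_moore_penrose A B by
  exact: (@xgetPex _ 0 _ (ex_intro _ B AB)).
pose C := col_base A; pose D := row_base A.
have CD : C *m D = A by exact: mulmx_base.
have uD : D *m D^T \in unitmx by apply: gram_unitmx; exact: row_base_free.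
have uC : C^T *m C \in unitmx.
  rewrite -[X in _ *m X]trmxK; apply: gram_unitmx.
  by rewrite /row_free mxrank_tr; exact: col_base_full.
pose X := D^T *m invmx (D *m D^T); pose Y := invmx (C^T *m C) *m C^T.
have DX : D *m X = 1%:M by rewrite mulmxA mulmxV.
have YC : Y *m C = 1%:M by rewrite -mulmxA mulVmx.
have CY : (C *m Y)^T = C *m Y.
  by rewrite /Y !(trmx_mul, trmx_inv, trmxK) !mulmxA.
have XD : (X *m D)^T = X *m D.
  by rewrite /X !(trmx_mul, trmx_inv, trmxK) !mulmxA.
have AX : A *m X = C.
  by transitivity (C *m D *m X); [rewrite CD | rewrite -mulmxA DX mulmx1].
have YA : Y *m A = D.
  by transitivity (Y *m (C *m D)); [rewrite CD | rewrite mulmxA YC mul1mx].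
have AXY : A *m (X *m Y) = C *m Y by rewrite mulmxA AX.
have XYA : X *m Y *m A = X *m D by rewrite -mulmxA YA.
exists (X *m Y); split; rewrite ?AXY ?XYA //.
  by rewrite -mulmxA YA.
by rewrite mulmxA -(mulmxA X) DX mulmx1.
Qed.

End LinearAlgebra.

Section Polygon.
Variables (R : realType) (N : nat).

Definition polygon : Type := 'I_N -> 'rV[R]_2.

(* The library norm on row vectors is the sup norm. *)
Definition enorm (v : 'rV[R]_2) : R := Num.sqrt (\sum_i v 0 i ^+ 2).

(* Rotation by pi/2: (a, b) |-> (- b, a). *)
Definition rot90 (v : 'rV[R]_2) : 'rV[R]_2 :=
  \row_i (if i == 0 then - v 0 1 else v 0 0).

(* Edge [j] joins vertex [j] to its cyclic successor [ordS j]; it carries the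
   half-integer index j + 1/2. *)
Definition edge (X : polygon) (j : 'I_N) : 'rV[R]_2 := X (ordS j) - X j.

Definition edge_tangent (X : polygon) (j : 'I_N) : 'rV[R]_2 :=
  (enorm (edge X j))^-1 *: edge X j.

Definition tangent_sum (X : polygon) (j : 'I_N) : 'rV[R]_2 :=
  edge_tangent X (ord_pred j) + edge_tangent X j.

Definition node_tangent (X : polygon) (j : 'I_N) : 'rV[R]_2 :=
  (enorm (tangent_sum X j))^-1 *: tangent_sum X j.

Definition node_normal (X : polygon) (j : 'I_N) : 'rV[R]_2 :=
  rot90 (node_tangent X j).

(* All denominators in the definitions of the tangents are nonzero. *)
Definition nondegenerate (X : polygon) : Prop :=
  forall j, enorm (edge X j) != 0 /\ enorm (tangent_sum X j) != 0.

(* A periodic continuous piecewise linear function on a polygon is represented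
   by its column of nodal values, so that [chi j] is the nodal basis. *)
Definition chi (j : 'I_N) : 'cV[R]_N := delta_mx j 0.

(* Discrete (mass-lumped) L^2 inner product: trapezoidal rule on each edge. *)
Definition inner_h (X : polygon) (u v : 'cV[R]_N) : R :=
  \sum_j enorm (edge X j) / 2 *
    (u j 0 * v j 0 + u (ordS j) 0 * v (ordS j) 0).

Definition lumped_mass (X : polygon) : 'M[R]_N :=
  \matrix_(k, j) inner_h X (chi j) (chi k).

Definition mass_vector (X : polygon) : 'cV[R]_N :=
  \col_j lumped_mass X j j.

(* Integral over the polygon of the product of the arclength derivatives, which
   are constant on each edge. *)
Definition stiffness_form (X : polygon) (u v : 'cV[R]_N) : R :=
  \sum_j enorm (edge X j) *
    ((u (ordS j) 0 - u j 0) / enorm (edge X j)) *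
    ((v (ordS j) 0 - v j 0) / enorm (edge X j)).

Definition stiffness (X : polygon) : 'M[R]_N :=
  \matrix_(k, j) stiffness_form X (chi j) (chi k).

Definition form_mx (B : {biscalar 'cV[R]_N}) : 'M[R]_N :=
  \matrix_(k, j) B (chi j) (chi k).

Definition load (X : polygon) (w : 'cV[R]_N) : 'cV[R]_N :=
  \col_k inner_h X w (chi k).

End Polygon.

Arguments polygon : clear implicits.

(* [GeneralMetric]: normal velocities range over R^N.
   [HminusOne]: the H^{-1} normal metric, with mean-free normal velocities. *)
Inductive normal_metric := GeneralMetric | HminusOne.

Section Scheme.
Variables (R : realType) (N K : nat).

Record functionals := Functionals {
  E_geom : polygon R N -> R;
  E_mesh : polygon R N -> R;
  constr : 'I_K -> polygon R N -> R;
  C_geom : R;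
  C_mesh : R }.

(* Data of one time step, all evaluated on the current polygon. *)
Record frozen_data := FrozenData {
  w_geom : 'cV[R]_N;
  w_mesh : 'cV[R]_N;
  g_constr : 'I_K -> 'cV[R]_N;
  G_nu : {biscalar 'cV[R]_N};
  G_tau : {biscalar 'cV[R]_N};
  D_nu : {biscalar 'cV[R]_N};
  D_tau : {biscalar 'cV[R]_N} }.

(* At time level n: the polygon, the scalars r_g and r_m, and the velocities and
   multipliers of level n, which were computed by the step from n - 1 to n. *)
Record state := State {
  curve : polygon R N;
  r_geom : R;
  r_mesh : R;
  V_nu : 'cV[R]_N;
  V_tau : 'cV[R]_N;
  lam : 'I_K -> R }.

Variables (P : functionals) (metric : normal_metric) (dt : R).

Definition normal_space (X : polygon R N) : set 'cV[R]_N :=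
  match metric with
  | GeneralMetric => setT
  | HminusOne => [set u | dotv (mass_vector X) u = 0]%classic
  end.

Definition A_nu (d : frozen_data) : 'M[R]_N := form_mx (G_nu d).
Definition A_tau (d : frozen_data) : 'M[R]_N := form_mx (G_tau d).
Definition Dmx_nu (d : frozen_data) : 'M[R]_N := form_mx (D_nu d).
Definition Dmx_tau (d : frozen_data) : 'M[R]_N := form_mx (D_tau d).
Definition M_nu (d : frozen_data) : 'M[R]_N := A_nu d + dt *: Dmx_nu d.
Definition M_tau (d : frozen_data) : 'M[R]_N := A_tau d + dt *: Dmx_tau d.

Definition normal_metric_spec (X : polygon R N) (d : frozen_data) : Prop :=
  match metric with
  | GeneralMetric => True
  | HminusOne =>
      A_nu d = lumped_mass X *m moore_penrose (stiffness X) *m lumped_mass X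
  end.

Definition S_geom (X : polygon R N) : R := Num.sqrt (E_geom P X + C_geom P).
Definition S_mesh (X : polygon R N) : R := Num.sqrt (E_mesh P X + C_mesh P).

(* For the H^{-1} metric the normal velocity equation is posed on the normal
   velocity space, i.e. tested against its elements. *)
Definition normal_equation (X : polygon R N) (lhs rhs : 'cV[R]_N) : Prop :=
  match metric with
  | GeneralMetric => lhs = rhs
  | HminusOne => forall phi, normal_space X phi -> dotv phi lhs = dotv phi rhs
  end.

(* One step of the fully discrete algebraic system, from [s] to [s']. *)
Definition sav_step (d : frozen_data) (s s' : state) : Prop :=
  let X := curve s in
  let Fg := load X (w_geom d) in
  let Fm := load X (w_mesh d) in
  let G i := load X (g_constr d i) in
  [/\ normal_space X (V_nu s'),
      normal_equation X (M_nu d *m V_nu s')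
        (- (r_geom s' / S_geom X) *: Fg - \sum_i lam s' i *: G i),
      M_tau d *m V_tau s' = - (r_mesh s' / S_mesh X) *: Fm &
  [/\ (r_geom s' - r_geom s) / dt =
        1 / (2 * S_geom X) * dotv Fg (V_nu s') +
        \sum_i lam s' i / (2 * r_geom s') * dotv (G i) (V_nu s'),
      (r_mesh s' - r_mesh s) / dt =
        1 / (2 * S_mesh X) * dotv Fm (V_tau s'),
      forall j, curve s' j = X j +
        dt *: (V_nu s' j 0 *: node_normal X j + V_tau s' j 0 *: node_tangent X j) &
      forall i, constr P i (curve s') = 0]].

(* Standing assumptions on the polygon and the data at one time level. *)
Definition admissible (X : polygon R N) (d : frozen_data) : Prop :=
  [/\ nondegenerate X, 0 < E_geom P X + C_geom P,
      0 < E_mesh P X + C_mesh P & normal_metric_spec X d].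

Definition metric_assumptions (X : polygon R N) (d : frozen_data) : Prop :=
  [/\ symmetric_mx (A_nu d) /\ pos_def_on (normal_space X) (A_nu d),
      symmetric_mx (A_tau d) /\ pos_def_on setT (A_tau d),
      symmetric_mx (Dmx_nu d) /\ pos_semidef (Dmx_nu d) &
      symmetric_mx (Dmx_tau d) /\ pos_semidef (Dmx_tau d)].

Definition step_hypotheses (d : frozen_data) (s s' : state) : Prop :=
  [/\ admissible (curve s) d, metric_assumptions (curve s) d,
      r_geom s' != 0 & sav_step d s s'].

End Scheme.

(* Main.v *)
(* Testing a velocity equation against the velocity itself expresses its metric
   plus stabilization quadratic form through the forces.  The matching scalar
   equation, multiplied by 2 r^{n+1}, has exactly the opposite right-hand side
   (the factor 1 / (2 r_g^{n+1}) in front of the multipliers cancels), so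
   2 r^{n+1} (r^{n+1} - r^n) / dt is minus the quadratic form.  Conclude by
   2 a (a - b) = a^2 - b^2 + (a - b)^2. *)

Require Import Defs.
From mathcomp Require Import all_boot all_order all_algebra.
From mathcomp Require Import boolp classical_sets reals.
From mathcomp Require Import ring.

Set Implicit Arguments.
Unset Strict Implicit.
Unset Printing Implicit Defensive.

Import Order.TTheory GRing.Theory Num.Theory.

Local Open Scope ring_scope.

Section DotProduct.
Variables (R : realType) (n : nat).
Implicit Types (u v w : 'cV[R]_n) (A B : 'M[R]_n).

Lemma dotvC u v : dotv u v = dotv v u.
Proof. by rewrite /dotv !mxE; apply: eq_bigr => i _; rewrite !mxE mulrC. Qed.

Lemma dotvZr u a v : dotv u (a *: v) = a * dotv u v.
Proof. by rewrite /dotv -scalemxAr mxE. Qed.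

Lemma dotvBr u v w : dotv u (v - w) = dotv u v - dotv u w.
Proof. by rewrite /dotv mulmxBr !mxE. Qed.

Lemma dotv_sumr (I : finType) u (f : I -> 'cV[R]_n) :
  dotv u (\sum_i f i) = \sum_i dotv u (f i).
Proof. by rewrite /dotv mulmx_sumr summxE. Qed.

Lemma dotv_mulmx A u : dotv u (A *m u) = quad A u.
Proof. by rewrite /dotv /quad mulmxA. Qed.

Lemma quadDZ A B a u : quad (A + a *: B) u = quad A u + a * quad B u.
Proof. by rewrite /quad mulmxDr -scalemxAr mulmxDl -scalemxAl !mxE. Qed.

(** Positive definiteness speaks only of nonzero vectors, so the zero velocity is treated apart. *)
Lemma quad_ge0 (W : set 'cV[R]_n) A u : pos_def_on W A -> W u -> 0 <= quad A u.
Proof.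
move=> posA Wu; have [->|u0] := eqVneq u 0; first by rewrite /quad mulmx0 mxE.
exact/ltW/posA.
Qed.

End DotProduct.

Lemma sqr_increment_le (R : realFieldType) (dt a b q : R) :
  0 < dt -> 2 * a * ((a - b) / dt) = q -> (a ^+ 2 - b ^+ 2) / dt <= q.
Proof.
move=> dt_gt0 <-; rewrite mulrA ler_pM2r ?invr_gt0 // -subr_ge0.
have -> : 2 * a * (a - b) - (a ^+ 2 - b ^+ 2) = (a - b) ^+ 2 by ring.
exact: sqr_ge0.
Qed.

(* Also true for S = 0, where both sides are 0. *)
Lemma sav_factor_cancel (R : realFieldType) (a S : R) :
  2 * a * (1 / (2 * S)) = a / S.
Proof. by rewrite invfM; move: S^-1 => T; field. Qed.

Section Dissipation.
Variables (R : realType) (N K : nat) (P : functionals R N K).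
Variables (metric : normal_metric) (dt : R) (d : frozen_data R N K).
Variables s s' : state R N K.

(** The tested form is common to both metrics: an equation in R^N implies it, and for [HminusOne] it
    is the equation itself. This lets one energy argument serve both cases. *)
Lemma normal_equation_dotv (X : polygon R N) (lhs rhs phi : 'cV[R]_N) :
  normal_equation metric X lhs rhs -> normal_space metric X phi ->
  dotv phi lhs = dotv phi rhs.
Proof. by case: metric => /= [-> //|eq_phi /eq_phi]. Qed.

Lemma geom_balance :
  r_geom s' != 0 -> sav_step P metric dt d s s' ->
  2 * r_geom s' * ((r_geom s' - r_geom s) / dt) =
  - quad (A_nu d) (V_nu s') - dt * quad (Dmx_nu d) (V_nu s').
Proof.
(* By [VW] the velocity is an admissible test vector for its own equation. *)
move=> r0 [VW /normal_equation_dotv /(_ VW) eqV _ [-> _ _ _]].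
rewrite -opprD -quadDZ -dotv_mulmx eqV dotvBr dotvZr dotv_sumr.
(* The energy force and the constraint forces are now matched separately. *)
rewrite mulrDr mulr_sumr opprB [RHS]addrC; congr (_ + _).
  by rewrite mulrA sav_factor_cancel dotvC mulNr opprK.
apply: eq_bigr => i _; rewrite dotvZr dotvC.
(* Here [r0] allows 2 r to cancel against the 1 / (2 r) of the multiplier term. *)
by field.
Qed.

Lemma mesh_balance :
  sav_step P metric dt d s s' ->
  2 * r_mesh s' * ((r_mesh s' - r_mesh s) / dt) =
  - quad (A_tau d) (V_tau s') - dt * quad (Dmx_tau d) (V_tau s').
Proof.
move=> [_ _ eqV [_ -> _ _]].
rewrite -opprD -quadDZ -dotv_mulmx eqV dotvZr mulNr opprK dotvC.
by rewrite mulrA sav_factor_cancel.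
Qed.

Hypothesis dt_gt0 : 0 < dt.

Lemma step_dissipation :
  step_hypotheses P metric dt d s s' ->
  ((r_geom s' ^+ 2 - r_geom s ^+ 2) / dt
     <= - quad (A_nu d) (V_nu s') - dt * quad (Dmx_nu d) (V_nu s') <= 0) /\
  ((r_mesh s' ^+ 2 - r_mesh s ^+ 2) / dt
     <= - quad (A_tau d) (V_tau s') - dt * quad (Dmx_tau d) (V_tau s') <= 0).
Proof.
move=> [_ [[_ posA] [_ posAt] [_ posD] [_ posDt]] r0 step].
have VW : normal_space metric (curve s) (V_nu s') by case: step.
(* The balances settle the left inequalities. The right ones then reduce to the nonnegativity of
   each metric and stabilization form at the velocity. *)
rewrite !(sqr_increment_le dt_gt0 (geom_balance _ _)) //.
rewrite !(sqr_increment_le dt_gt0 (mesh_balance _)) //.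
rewrite -!opprD !oppr_le0 !addr_ge0 ?(mulr_ge0 (ltW dt_gt0)) //.
  exact: (quad_ge0 posAt).
exact: (quad_ge0 posA).
Qed.

Lemma step_nonincreasing :
  step_hypotheses P metric dt d s s' ->
  r_geom s' ^+ 2 <= r_geom s ^+ 2 /\ r_mesh s' ^+ 2 <= r_mesh s ^+ 2.
Proof.
case/step_dissipation => /andP[g1 g2] /andP[m1 m2].
have sqr_le (a b : R) : (a - b) / dt <= 0 -> a <= b.
  by rewrite pmulr_lle0 ?invr_gt0 // subr_le0.
by split; apply: sqr_le; [exact: le_trans g2 | exact: le_trans m2].
Qed.

End Dissipation.

Theorem theorem6p1 (R : realType) (N K : nat) (P : functionals R N K)
    (metric : normal_metric) (dt : R)
    (d : nat -> frozen_data R N K) (s : nat -> state R N K) :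
  0 < dt -> 0 < C_geom P -> 0 < C_mesh P ->
  (forall n : nat, step_hypotheses P metric dt (d n) (s n) (s n.+1) ->
     (r_geom (s n.+1) ^+ 2 - r_geom (s n) ^+ 2) / dt
       <= - quad (A_nu (d n)) (V_nu (s n.+1))
          - dt * quad (Dmx_nu (d n)) (V_nu (s n.+1))
       <= 0
     /\
     (r_mesh (s n.+1) ^+ 2 - r_mesh (s n) ^+ 2) / dt
       <= - quad (A_tau (d n)) (V_tau (s n.+1))
          - dt * quad (Dmx_tau (d n)) (V_tau (s n.+1))
       <= 0)
  /\
  (forall m n : nat, (m <= n)%N ->
     (forall k : nat, (m <= k < n)%N ->
        step_hypotheses P metric dt (d k) (s k) (s k.+1)) ->
     r_geom (s n) ^+ 2 <= r_geom (s m) ^+ 2 /\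
     r_mesh (s n) ^+ 2 <= r_mesh (s m) ^+ 2).
Proof.
move=> dt_gt0 _ _; split=> [n|m n]; first exact: step_dissipation.
(* Induction on the final time level with [m] fixed: the hypotheses before level [n] feed [IHn], and
   the one at level [n] supplies the last decrease. *)
elim: n => [|n IHn]; first by rewrite leqn0 => /eqP ->.
rewrite leq_eqVlt => /predU1P[-> //|]; rewrite ltnS => le_mn hyp.
have [|g m_] := IHn le_mn.
  by move=> k /andP[mk kn]; apply: hyp; rewrite mk ltnW.
have [|g' m'] := step_nonincreasing dt_gt0 (hyp n _); first by rewrite le_mn /=.
by split; [exact: le_trans g | exact: le_trans m_].
Qed.
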